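(* Consider the stochastic optimization problem of the context: minimize $\limsup_{t\to\infty}\overline{y}_0(t)$ subject to $\limsup_{t\to\infty}\overline{y}_k(t)\le c_k$ for all $k\in\{1,\dots,K\}$ and $y(t)\in\mathcal{Y}(\omega(t))$ for all $t\in\{0,1,2,\dots\}$, under the i.i.d., boundedness and compactness assumptions stated there. Suppose that this problem is feasible, with optimal value $y_0^{opt}$, and that there is a vector $\mu=(\mu_1,\dots,\mu_K)$ with non-negative components (a Lagrange multiplier vector) such that $$y_0+\sum_{k=1}^K\mu_k y_k\;\ge\; y_0^{opt}+\sum_{k=1}^K\mu_k c_k\qquad\text{for all }(y_0,y_1,\dots,y_K)\in\overline{\mathcal{R}}.$$ Fix $\epsilon>0$ and run the drift-plus-penalty algorithm (defined in the context) with parameter $V=1/\epsilon$. Then for all integers $t\ge 1/\epsilon^2$, $$\overline{y}_0(t)\le y_0^{opt}+O(\epsilon),\qquad \overline{y}_k(t)\le c_k+O(\epsilon)\quad\text{for all }k\in\{1,\dots,K\}.$$ That is, the drift-plus-penalty algorithm with $V=1/\epsilon$ provides an $O(\epsilon)$ approximation with convergence time $O(1/\epsilon^2)$. Here $O(\epsilon)$ denotes a quantity bounded by $C\epsilon$, where $C$ is a finite constant that does not depend on $\epsilon$ or $t$.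
   Context: Setting. $K$ is a positive integer, and time slots are $t\in\{0,1,2,\dots\}$. Random events $\omega(t)$, $t\ge 0$, are i.i.d. elements of an arbitrary set $\Omega$. For each $\omega\in\Omega$ there is an option set $\mathcal{Y}(\omega)\subseteq\mathbb{R}^{K+1}$. On every slot $t$ a controller observes $\omega(t)$ and chooses a vector $y(t)=(y_0(t),y_1(t),\dots,y_K(t))\in\mathcal{Y}(\omega(t))$, possibly at random, with a distribution that may depend on $\omega(t)$ and on the observed history up to slot $t$. A policy (or algorithm) is any such rule; $\omega(t)$ is independent of the history before slot $t$. All decisions are assumed to be (measurable) random vectors. The real numbers $c_1,\dots,c_K$ are given. For integers $t>0$ and $k\in\{0,1,\dots,K\}$, define $$\overline{y}_k(t)=\frac1t\sum_{\tau=0}^{t-1}\mathbb{E}[y_k(\tau)].$$ Boundedness assumption. There are non-negative constants $h_0,h_1,\dots,h_K$ such that under any policy and for every slot $t$, $\mathbb{E}[|y_0(t)|]\le h_0$ and $\mathbb{E}[y_k(t)^2]\le h_k$ for all $k\in\{1,\dots,K\}$. Compactness assumption. For every $\omega\in\Omega$ the set $\mathcal{Y}(\omega)$ is a compact subset of $\mathbb{R}^{K+1}$. Feasibility and optimal value. The problem is feasible if some policy satisfies its constraints ($\limsup_{t\to\infty}\overline{y}_k(t)\le c_k$ for all $k\in\{1,\dots,K\}$ and $y(t)\in\mathcal{Y}(\omega(t))$ for all $t$). $y_0^{opt}$ is the infimum of $\limsup_{t\to\infty}\overline{y}_0(t)$ over all policies that satisfy the constraints. The set $\mathcal{R}$.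 $\mathcal{R}\subseteq\mathbb{R}^{K+1}$ is the set of all expectation vectors $\mathbb{E}[y(t)]$ that can be achieved on a single slot by choosing $y(t)\in\mathcal{Y}(\omega(t))$ at random according to some conditional distribution given $\omega(t)$; the expectation is over both $\omega(t)$ and the conditional randomness. $\overline{\mathcal{R}}$ is the closure of $\mathcal{R}$. The set $\mathcal{R}$ is convex and bounded. It is a known fact, from earlier literature, that the stochastic problem is feasible if and only if the static problem ''minimize $y_0$ subject to $y_k\le c_k$ for all $k\in\{1,\dots,K\}$ and $(y_0,\dots,y_K)\in\overline{\mathcal{R}}$'' is feasible, and that in this case both have the same optimal value $y_0^{opt}$. Drift-plus-penalty algorithm with parameter $V>0$. Initialize $Q_k(0)=0$ for all $k\in\{1,\dots,K\}$. On every slot $t\in\{0,1,2,\dots\}$: observe $Q_1(t),\dots,Q_K(t)$ and $\omega(t)$, and choose $(y_0(t),\dots,y_K(t))\in\mathcal{Y}(\omega(t))$ that exactly minimizes $Vy_0(t)+\sum_{k=1}^KQ_k(t)y_k(t)$ over $\mathcal{Y}(\omega(t))$; then update $Q_k(t+1)=\max[Q_k(t)+y_k(t)-c_k,\,0]$ for all $k\in\{1,\dots,K\}$. Convergence time. An algorithm is said to produce an $O(\epsilon)$ approximation with convergence time $T$ if for all $t\ge T$ one has $\overline{y}_0(t)\le y_0^{opt}+O(\epsilon)$ and $\overline{y}_k(t)\le c_k+O(\epsilon)$ for all $k\in\{1,\dots,K\}$. *)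

(* Defs.v *)
From mathcomp Require Import all_boot all_order all_algebra.
From mathcomp Require Import all_classical all_reals all_analysis.

Set Implicit Arguments.
Unset Strict Implicit.
Unset Printing Implicit Defensive.

Import Order.TTheory GRing.Theory Num.Theory.
Import numFieldNormedType.Exports.

Local Open Scope classical_set_scope.
Local Open Scope ring_scope.

(** [R^(K+1)] with its Borel sigma-algebra. *)
Notation vec R K := (g_sigma_algebraType (@open 'rV[R]_K.+1)).

Definition ycoord (R : realType) (K : nat) (i : 'I_K.+1) (v : vec R K) : R :=
  (v : 'rV[R]_K.+1) ord0 i.

(** Index 0 of a vector is the objective [y_0]; the constraint index
    [k : 'I_K] stands for [y_(k+1)], i.e. for coordinate [cidx k]. *)
Definition cidx (K : nat) (k : 'I_K) : 'I_K.+1 := lift ord0 k.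

Section Problem.
Context {d : measure_display} {Omega : measurableType d} {R : realType}.
Context {K : nat}.

(** [rho] is the common law of the events, [Y w] the option set of [w], and
    [c] the right-hand sides of the constraints. *)
Implicit Types (rho : probability Omega R) (Y : Omega -> set 'rV[R]_K.+1).
Implicit Types (c : 'I_K -> R) (h : 'I_K.+1 -> R).

(** What has been observed before slot [t]: the pairs (event, decision) of
    the slots [0, ..., t-1]. *)
Notation history t := (t.-tuple (Omega * vec R K)).

(** The conditional distribution of the decision of slot [t], given the
    history before slot [t] and the event of slot [t]. No measurability of
    [w |-> Y w] is assumed, so being supported in [Y w] has to be asked of
    the kernel itself; a joint law would not determine it. *)
Definition policy := forall t : nat, R.-pker (history t * Omega) ~> vec R K.

Definition admissible Y (p : policy) :=
  forall t (g : history t) (w : Omega), p t (g, w) (Y w) = 1%E.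

Section Run.
Context {dS : measure_display} {S : measurableType dS}.
Variables (P : probability S R).
Variables (om : nat -> S -> Omega) (y : nat -> S -> vec R K).

Definition hist (t : nat) (s : S) : history t := [tuple (om i s, y i s) | i < t].

(** [om] and [y] are the events and the decisions under the policy [p], on
    the probability space [(S, P)]. Since the history before slot [t]
    contains [om 0, ..., om (t-1)], the conditions [run_law] and [run_indep]
    include that the [om t] are i.i.d. *)
Record run rho Y (p : policy) : Prop := Run {
  run_meas_om : forall t, measurable_fun setT (om t) ;
  run_meas_y : forall t, measurable_fun setT (y t) ;
  run_law : forall t (A : set Omega), measurable A ->
    P (om t @^-1` A) = rho A ;
  run_indep : forall t (G : set (history t)) (A : set Omega),
    measurable G -> measurable A ->
    P (hist t @^-1` G `&` om t @^-1` A) =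
      (P (hist t @^-1` G) * P (om t @^-1` A))%E ;
  run_option : forall t s, Y (om t s) (y t s) ;
  run_cond : forall t (A : set (history t * Omega)) (B : set (vec R K)),
    measurable A -> measurable B ->
    P ((fun s => (hist t s, om t s)) @^-1` A `&` y t @^-1` B) =
      (\int[P]_(s in (fun s => (hist t s, om t s)) @^-1` A)
         p t (hist t s, om t s) B)%E }.

(** The time average of the expectations over the slots [0, ..., t-1]. *)
Definition avg (i : 'I_K.+1) (t : nat) : \bar R :=
  ((t%:R^-1)%:E * \sum_(tau < t) 'E_P[ycoord i \o y tau])%E.

Definition meets_constraints c :=
  forall k : 'I_K, (limn_esup (avg (cidx k)) <= (c k)%:E)%E.

Fixpoint queue c (k : 'I_K) (t : nat) (s : S) : R :=
  if t is u.+1 then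
    Num.max (queue c k u s + ycoord (cidx k) (y u s) - c k) 0
  else 0.

Definition dpp_objective c (V : R) (t : nat) (s : S) (z : vec R K) : R :=
  V * ycoord ord0 z + \sum_(k < K) queue c k t s * ycoord (cidx k) z.

(** The decisions are those of drift-plus-penalty with parameter [V]; ties
    between minimizers may be broken in any way. *)
Definition drift_plus_penalty Y c (V : R) :=
  forall t s (z : vec R K), Y (om t s) z ->
    dpp_objective c V t s (y t s) <= dpp_objective c V t s z.

End Run.

Definition bounded_moments rho Y h :=
  forall p : policy, admissible Y p ->
  forall (dS : measure_display) (S : measurableType dS) (P : probability S R)
    (om : nat -> S -> Omega) (y : nat -> S -> vec R K),
  run P om y rho Y p ->
  forall t,
    ('E_P[fun s => `|ycoord ord0 (y t s)|%R] <= (h ord0)%:E)%E /\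
    forall k : 'I_K,
      ('E_P[fun s => (ycoord (cidx k) (y t s) ^+ 2)%R] <= (h (cidx k))%:E)%E.

(** The values of [limsup_t avg 0 t] over the policies that meet the
    constraints. *)
Definition feasible_values rho Y c : set (\bar R) :=
  [set v | exists p : policy, admissible Y p /\
    exists (dS : measure_display) (S : measurableType dS)
      (P : probability S R) (om : nat -> S -> Omega) (y : nat -> S -> vec R K),
    [/\ run P om y rho Y p, meets_constraints P y c
      & v = limn_esup (avg P y ord0)]].

Definition feasible rho Y c := feasible_values rho Y c !=set0.

Definition optimal_value rho Y c : \bar R := ereal_inf (feasible_values rho Y c).

(** The expectation vectors [v] that a conditional distribution [kappa] of the
    decision given the event achieves on a single slot. The first condition
    on [i] says that the expectation exists as a real number. *)
Definition achievable rho Y : set 'rV[R]_K.+1 :=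
  [set v | exists kappa : R.-pker Omega ~> vec R K,
    (forall w, kappa w (Y w) = 1%E) /\
    forall i : 'I_K.+1,
      (\int[rho]_w \int[kappa w]_z `|ycoord i z|%:E < +oo)%E /\
      (\int[rho]_w \int[kappa w]_z (ycoord i z)%:E = (v ord0 i)%:E)%E].

Definition lagrange_multiplier rho Y c (y0opt : R) (mu : 'I_K -> R) :=
  (forall k, 0 <= mu k) /\
  forall v : 'rV[R]_K.+1, closure (achievable rho Y) v ->
    y0opt + \sum_(k < K) mu k * c k <=
      v ord0 ord0 + \sum_(k < K) mu k * v ord0 (cidx k).

End Problem.

(* Main.v *)
Require Import Defs.
From HB Require Import structures.
From mathcomp Require Import all_boot all_order all_algebra ring lra.
From mathcomp Require Import all_classical all_reals all_analysis.
From mathcomp Require Import measurable_realfun.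

Set Implicit Arguments.
Unset Strict Implicit.
Unset Printing Implicit Defensive.

Import Order.TTheory GRing.Theory Num.Theory.
Import numFieldNormedType.Exports.

Local Open Scope classical_set_scope.
Local Open Scope ring_scope.

(** The proof is a drift argument on [\sum_k E[Q_k(t)^2]]. Given the history,
    the decision of slot [t] minimizes [V y_0 + \sum_k Q_k(t) y_k], and [Q(t)]
    is independent of the event of slot [t], so the expected objective is at
    most [V v_0 + \sum_k E[Q_k(t)] v_k] for every achievable vector [v]. Take
    for [v] the expectation vectors of the successive slots of a nearly optimal
    feasible run and average: since the bound is linear in [v], this gives
    [V y0opt + \sum_k E[Q_k(t)] c_k] without the convexity of the achievable set
    or the static reformulation. Summing the drift, with [B] bounding the second
    moments,
      [\sum_k E[Q_k(t)^2] <= B t + 2 V (t y0opt - \sum_(u < t) E[y_0(u)])],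
    whence the bound on the objective. The multiplier inequality, applied to
    the expectation vector of each slot, bounds the last bracket by
    [\sum_k mu_k E[Q_k(t)]]; the resulting quadratic inequality makes
    [E[Q_k(t)]] of order [sqrt t + V], and [E[Q_k(t)] / t] dominates the
    violation of the constraint [k]. *)

(** * Laws of random variables and independence *)

(** The law is prescribed by its values on measurable sets, so that [m] can be [rho], a product
    measure or a composition of kernels as well as a pushforward. *)
Lemma ge0_integral_law {d1 d2} {S : measurableType d1} {T : measurableType d2}
    {R : realType} (P : probability S R) (X : S -> T)
    (m : {measure set T -> \bar R}) :
  measurable_fun setT X ->
  (forall A, measurable A -> P (X @^-1` A) = m A) ->
  forall f : T -> \bar R, measurable_fun setT f -> (forall z, 0 <= f z)%E ->
  (\int[P]_s f (X s) = \int[m]_z f z)%E.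
Proof.
move=> mX PX f mf f0.
pose X' : {mfun S >-> T} := HB.pack X (isMeasurableFun.Build _ _ _ _ _ mX).
rewrite -[LHS](ge0_integral_distribution X' mf f0).
by apply: eq_measure_integral => A mA _; rewrite -PX.
Qed.

Lemma integral_law {d1 d2} {S : measurableType d1} {T : measurableType d2}
    {R : realType} (P : probability S R) (X : S -> T)
    (m : {measure set T -> \bar R}) :
  measurable_fun setT X ->
  (forall A, measurable A -> P (X @^-1` A) = m A) ->
  forall f : T -> \bar R, measurable_fun setT f ->
  (\int[P]_s f (X s) = \int[m]_z f z)%E.
Proof.
move=> mX PX f mf; rewrite [LHS]integralE [RHS]integralE.
rewrite -(ge0_integral_law mX PX (measurable_funepos mf))//.
rewrite -(ge0_integral_law mX PX (measurable_funeneg mf))//.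
by congr (_ - _)%E; apply: eq_integral => s _; rewrite ?funeposE ?funenegE.
Qed.

Lemma integrable_law {d1 d2} {S : measurableType d1} {T : measurableType d2}
    {R : realType} (P : probability S R) (X : S -> T)
    (m : {measure set T -> \bar R}) :
  measurable_fun setT X ->
  (forall A, measurable A -> P (X @^-1` A) = m A) ->
  forall f : T -> \bar R, m.-integrable setT f ->
  P.-integrable setT (f \o X).
Proof.
move=> mX PX f /integrableP[mf foo]; apply/integrableP; split.
  exact: measurableT_comp.
rewrite (ge0_integral_law mX PX (f := abse \o f))//.
  exact: measurableT_comp.
by move=> z /=.
Qed.

Lemma indep_pair_law {d1 d2 d3} {S : measurableType d1} {T : measurableType d2}
    {U : measurableType d3} {R : realType} (P : probability S R)
    (X : S -> T) (W : S -> U) (m1 : probability T R) (m2 : probability U R) :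
  measurable_fun setT X -> measurable_fun setT W ->
  (forall A B, measurable A -> measurable B ->
     P (X @^-1` A `&` W @^-1` B) = m1 A * m2 B)%E ->
  forall C, measurable C ->
    P ((fun s => (X s, W s)) @^-1` C) = (m1 \x m2)%E C.
Proof.
move=> mX mW PXW C mC.
pose XW : {mfun S >-> (T * U)%type} := HB.pack (fun s => (X s, W s))
  (isMeasurableFun.Build _ _ _ _ _ (measurable_fun_pair mX mW)).
exact/esym/(@product_measure_unique _ _ _ _ _ m1 m2 (distribution P XW)).
Qed.

(** The joint law of [(X, W)] is a product measure, so Fubini factors the expectation, and first
    moments suffice for integrability. It serves with [X] a queue and [W] the event of the slot. *)
Lemma indep_mul {d1 d3} {S : measurableType d1}
    {U : measurableType d3} {R : realType} (P : probability S R)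
    (X : S -> R) (W : S -> U) (rho : probability U R) (g : U -> R) :
  measurable_fun setT W ->
  (forall A B, measurable A -> measurable B ->
     P (X @^-1` A `&` W @^-1` B) = P (X @^-1` A) * rho B)%E ->
  P.-integrable setT (EFin \o X) -> rho.-integrable setT (EFin \o g) ->
  P.-integrable setT (EFin \o (fun s => X s * g (W s))) /\
  (\int[P]_s (X s * g (W s)) = \int[P]_s X s * \int[rho]_w g w)%R.
Proof.
move=> mW PXW iX ig.
have mX : measurable_fun setT X by apply/measurable_EFinP; case/integrableP: iX.
have mg : measurable_fun setT g by apply/measurable_EFinP; case/integrableP: ig.
pose X' : {mfun S >-> R} := HB.pack X (isMeasurableFun.Build _ _ _ _ _ mX).
pose m1 : probability R R := distribution P X'.
have lawX A : measurable A -> P (X @^-1` A) = m1 A by [].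
have mE : measurable_fun setT (@EFin R).
  by apply/measurable_EFinP; exact: measurable_id.
have im1 : m1.-integrable setT EFin.
  case/integrableP: iX => _ iX; apply/integrableP; split => //.
  rewrite -(ge0_integral_law mX lawX (f := abse \o EFin))//.
    exact: measurableT_comp.
  by move=> z /=.
pose f : R * U -> \bar R := fun z => (z.1 * g z.2)%:E.
have mf : measurable_fun setT f.
  apply/measurable_EFinP; apply: measurable_funM => //.
  exact: measurableT_comp.
have law := indep_pair_law (m1 := m1) mX mW PXW.
have mng : measurable_fun setT (fun w => `|g w|%:E).
  by apply/measurable_EFinP; apply: measurableT_comp.
have inner x : (\int[rho]_w `|f (x, w)| = `|x|%:E * \int[rho]_w `|g w|%:E)%E.
  rewrite -ge0_integralZl//.
  by apply: eq_integral => w _; rewrite /f/= normrM EFinM.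
have iff : (m1 \x rho)%E.-integrable setT f.
  apply/(integrable12ltyP _ _ mf).
  under eq_integral do rewrite inner.
  have [_ goo] := integrableP _ _ _ ig.
  have [mx xoo] := integrableP _ _ _ im1.
  rewrite ge0_integralZr//; last 2 first.
    by apply/measurable_EFinP; exact: normr_measurable.
    exact: integral_ge0.
  by apply: lte_mul_pinfty => //; rewrite ?ge0_fin_numE//; exact: integral_ge0.
have mXW := measurable_fun_pair mX mW.
split; first exact: (integrable_law mXW law iff).
rewrite /Rintegral (integral_law mXW law mf) -integral12_prod_meas1//.
have [r rE] : exists r, (\int[rho]_w (g w)%:E = r%:E)%E.
  by exists (fine (\int[rho]_w (g w)%:E)%E); rewrite fineK// integrable_fin_num.
have innerg x : (fubini_F rho f x = x%:E * r%:E)%E.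
  rewrite -rE -integralZl//.
rewrite (eq_integral (fun x : R => x%:E * r%:E)%E); last first.
  by move=> x _; exact: innerg.
rewrite rE integralZr// fineM//; last exact: integrable_fin_num.
by rewrite -(integral_law mX lawX)//; case/integrableP: im1.
Qed.

(** * Kernels: averaging the history out of a policy *)

Section kernel_precomposition.
Context {d1 d2 d3} {W : measurableType d1} {X : measurableType d2}
  {Z : measurableType d3} {R : realType}.
Variables (k : R.-pker X ~> Z) (f : W -> X).

Definition kprecomp (mf : measurable_fun setT f) :
  W -> {measure set Z -> \bar R} := k \o f.

Hypothesis mf : measurable_fun setT f.

Let kprecomp_measurable U : measurable U ->
  measurable_fun setT (kprecomp mf ^~ U).
Proof. by move=> mU; exact: measurableT_comp (measurable_kernel k U mU) mf. Qed.

HB.instance Definition _ :=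
  isKernel.Build _ _ _ _ _ (kprecomp mf) kprecomp_measurable.

Let kprecomp_prob w : kprecomp mf w setT = 1%E.
Proof. exact: prob_kernel. Qed.

HB.instance Definition _ :=
  Kernel_isProbability.Build _ _ _ _ _ (kprecomp mf) kprecomp_prob.

End kernel_precomposition.

Section mixture.
Context {d1 d2 d3} {T : measurableType d1} {X : measurableType d2}
  {Z : measurableType d3} {R : realType}.
Variables (m : probability T R) (k : R.-pker (T * X) ~> Z).

(** Kernel composition feeds the second kernel the pair (source, intermediate point), while a policy
    takes the history first; hence the swap. *)
Let mswap : measurable_fun setT (fun z : X * T => (z.2, z.1)).
Proof. exact: measurable_fun_pair. Qed.

Let l : R.-pker X ~> T :=
  kprobability (@measurable_cst _ _ X _ setT (m : pprobability T R)).
Let k' : R.-pker (X * T) ~> Z := kprecomp k mswap.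

(** The conditional law of a decision given the event alone, when the history is drawn from [m]
    independently of the event. *)
Definition mixture : X -> {measure set Z -> \bar R} := mkcomp l k'.

Let mixture_measurable U : measurable U -> measurable_fun setT (mixture ^~ U).
Proof.
move=> mU.
exact: (@KCOMP_FINITE_KERNEL.measurable_fun_kcomp_finite _ _ _ _ _ _ _ l k').
Qed.

HB.instance Definition _ :=
  isKernel.Build _ _ _ _ _ mixture mixture_measurable.

Let mixture_prob x : mixture x setT = 1%E.
Proof.
rewrite /mixture/= /kcomp (eq_integral (cst 1%E)); last first.
  by move=> t _; exact: prob_kernel.
by rewrite integral_cst// mul1e; exact: probability_setT.
Qed.

HB.instance Definition _ :=
  Kernel_isProbability.Build _ _ _ _ _ mixture mixture_prob.

Lemma mixtureE x B : mixture x B = (\int[m]_t k (t, x) B)%E.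
Proof. by []. Qed.

End mixture.

(** Independence makes [m \x rho] the law of [(G, W)]; Tonelli integrates the history out first,
    which leaves the mixture kernel under [rho]. *)
Lemma integral_conditional_law {d1 d2 d3 d4} {S : measurableType d1}
    {T : measurableType d2} {X : measurableType d3} {Z : measurableType d4}
    {R : realType} (P : probability S R) (G : S -> T) (W : S -> X) (y : S -> Z)
    (m : probability T R) (rho : probability X R) (k : R.-pker (T * X) ~> Z) :
  measurable_fun setT G -> measurable_fun setT W -> measurable_fun setT y ->
  (forall A B, measurable A -> measurable B ->
     P (G @^-1` A `&` W @^-1` B) = m A * rho B)%E ->
  (forall B, measurable B -> P (y @^-1` B) = \int[P]_s k (G s, W s) B)%E ->
  forall f : Z -> \bar R, measurable_fun setT f -> (forall z, 0 <= f z)%E ->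
  (\int[P]_s f (y s) = \int[rho]_w \int[mixture m k w]_z f z)%E.
Proof.
move=> mG mW my PGW Py f mf f0.
have msnd : measurable_fun setT (@snd unit X) by exact: measurable_snd.
(* The law of the event becomes a constant kernel out of [unit], so that the law of [y] is a
   composition of kernels evaluated at [tt]. *)
pose l : R.-pker unit ~> X :=
  kprobability (@measurable_cst _ _ unit _ setT (rho : pprobability X R)).
pose k' : R.-pker (unit * X) ~> Z := kprecomp (mixture m k) msnd.
rewrite (ge0_integral_law (m := mkcomp l k' tt) my _ mf f0) ?integral_kcomp//.
move=> B mB; rewrite Py// /mkcomp/= /kcomp.
have mk : measurable_fun setT (k ^~ B) by exact: measurable_kernel.
rewrite (ge0_integral_law (measurable_fun_pair mG mW)
  (indep_pair_law mG mW PGW) mk)// fubini_tonelli2//.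
Qed.

(** * Measurability on [vec R K], and the expectation vector of one slot of a run *)

Lemma measurable_ycoord (R : realType) (K : nat) (i : 'I_K.+1) :
  measurable_fun setT (ycoord i : vec R K -> R).
Proof.
apply: (measurability _ (RGenOpens.measurableE R)) => _ [_ [a [b ->] <-]].
rewrite setTI; apply: sub_sigma_algebra => /=.
have /continuousP := @coord_continuous R 1 K.+1 ord0 i.
by apply; exact: interval_open.
Qed.

Lemma measurable_compact (R : realType) (K : nat) (A : set 'rV[R]_K.+1) :
  compact A -> measurable (A : set (vec R K)).
Proof.
move=> cA; rewrite -(setCK A); apply: measurableC.
apply: sub_sigma_algebra => /=; apply: closed_openC.
by apply: compact_closed => //; exact: norm_hausdorff.
Qed.

Section SlotLaw.
Context {d : measure_display} {Omega : measurableType d} {R : realType}.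
Context {K : nat}.
Context {dS : measure_display} {S : measurableType dS}.
Variables (P : probability S R) (rho : probability Omega R).
Variables (Y : Omega -> set 'rV[R]_K.+1) (p : @policy d Omega R K).
Variables (om : nat -> S -> Omega) (y : nat -> S -> vec R K).
Hypothesis adm : admissible Y p.
Hypothesis rn : run P om y rho Y p.

Lemma measurable_hist t : measurable_fun setT (hist om y t).
Proof.
apply/measurable_fun_tnthP => i.
rewrite (_ : _ \o _ = fun s => (om i s, y i s)); last first.
  by apply/funext => s /=; rewrite tnth_mktuple.
apply: measurable_fun_pair; [exact: (run_meas_om rn)|exact: (run_meas_y rn)].
Qed.

Lemma measurable_decision i t : measurable_fun setT (ycoord i \o y t).
Proof.
apply: measurableT_comp; [exact: measurable_ycoord|exact: (run_meas_y rn)].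
Qed.

(** A policy may look at the history, an achievable vector only at the event. Averaging the kernel
    of slot [t] over the law of the history removes this dependence and keeps the expectations. *)
Lemma run_integrable_achievable t :
  (forall i, P.-integrable setT (EFin \o (ycoord i \o y t))) ->
  achievable rho Y (\row_i \int[P]_s ycoord i (y t s))%R.
Proof.
move=> iy.
pose H : {mfun S >-> t.-tuple (Omega * vec R K)} :=
  HB.pack (hist om y t) (isMeasurableFun.Build _ _ _ _ _ (@measurable_hist t)).
pose m : probability _ R := distribution P H.
have law f := integral_conditional_law (m := m) (rho := rho) (k := p t)
  (@measurable_hist t) (run_meas_om rn t) (run_meas_y rn t) _ _ (f := f).
have {}law f : measurable_fun setT f -> (forall z, 0 <= f z)%E ->
    (\int[P]_s f (y t s) = \int[rho]_w \int[mixture m (p t) w]_z f z)%E.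
  apply: law => [A B mA mB|B mB].
  - by rewrite (run_indep rn)// (run_law rn).
  - have := run_cond rn measurableT mB (t := t).
    by rewrite preimage_setT setTI.
exists (mixture m (p t)); split => [w|i].
  rewrite mixtureE (eq_integral (cst 1%E)); last by move=> g _; exact: adm.
  by rewrite integral_cst// mul1e; exact: probability_setT.
have mi : measurable_fun setT (EFin \o (ycoord i : vec R K -> R)).
  by apply/measurable_EFinP; exact: measurable_ycoord.
have [mP iP] := integrableP _ _ _ (iy i).
split.
  rewrite -(law (abse \o (EFin \o ycoord i)))//.
    exact: measurableT_comp.
  by move=> z /=.
(* [law] covers nonnegative functions only, so the positive and negative parts are treated apart;
   [part] makes their integrals subtractable. *)
have mpos := measurable_funepos mi; have mneg := measurable_funeneg mi.
have part f : measurable_fun setT f -> (forall z, 0 <= f z)%E ->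
    P.-integrable setT (fun s => f (y t s)) ->
    rho.-integrable setT (fun w => \int[mixture m (p t) w]_z f z)%E.
  move=> mf f0 [/integrableP[_ fi]]; apply/integrableP; split.
    by apply: measurable_fun_integral_kernel => // U mU; exact: measurable_kernel.
  under eq_integral do rewrite gee0_abs ?integral_ge0//.
  rewrite -law//; apply: le_lt_trans fi.
  by under [leRHS]eq_integral do rewrite gee0_abs//.
under eq_integral do rewrite integralE.
rewrite integralB//; last 2 first.
- apply: (part _ mpos) => //.
  by have := integrable_funepos measurableT (iy i); rewrite compA funepos_comp.
- apply: (part _ mneg) => //.
  by have := integrable_funeneg measurableT (iy i); rewrite compA funeneg_comp.
rewrite -(law _ mpos)// -(law _ mneg)// mxE /Rintegral fineK; last first.
  exact: integrable_fin_num (iy i).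
rewrite [RHS]integralE.
by congr (_ - _)%E; apply: eq_integral => s _; rewrite ?funeposE ?funenegE.
Qed.

End SlotLaw.

(** * Comparison and finite sums of real-valued integrals *)

Section real_integrals.
Context {d} {T : measurableType d} {R : realType}.
Variable mu : {measure set T -> \bar R}.

Lemma ae_le_Rintegral (f g : T -> R) :
  mu.-integrable setT (EFin \o f) -> mu.-integrable setT (EFin \o g) ->
  {ae mu, forall x, f x <= g x} -> \int[mu]_x f x <= \int[mu]_x g x.
Proof.
move=> fi gi fg; rewrite -subr_ge0 -RintegralB//.
have /integrableP[mh _] := integrableB measurableT gi fi.
rewrite /Rintegral (ae_eq_integral (fun x => `|(g x - f x)%:E|)%E)//.
- by apply: fine_ge0; exact: integral_ge0.
- exact: measurableT_comp mh.
- apply: filterS fg => x fg _; by rewrite /= ger0_norm ?subr_ge0.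
Qed.

Lemma Rintegral_sum (I : Type) (r : seq I) (f : I -> T -> R) :
  (forall i, mu.-integrable setT (EFin \o f i)) ->
  mu.-integrable setT (EFin \o (fun x => \sum_(i <- r) f i x)) /\
  \int[mu]_x (\sum_(i <- r) f i x) = \sum_(i <- r) \int[mu]_x f i x.
Proof.
move=> fi; elim: r => [|i r [ir IH]].
  under [X in EFin \o X]eq_fun do rewrite big_nil.
  under eq_Rintegral do rewrite big_nil.
  by rewrite big_nil Rintegral_cst// mul0r; split => //; exact: integrable0.
under [X in EFin \o X]eq_fun do rewrite big_cons.
under eq_Rintegral do rewrite big_cons.
rewrite big_cons RintegralD// IH; split => //.
exact: (integrableD measurableT (fi i) ir).
Qed.

(** Serves to compare a minimum over [A] with the average under a probability carried by [A]. *)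
Lemma cst_le_Rintegral (A : set T) (f : T -> R) (a : R) :
  mu setT = 1%E -> measurable A -> mu A = 1%E ->
  mu.-integrable setT (EFin \o f) -> (forall x, A x -> a <= f x) ->
  a <= \int[mu]_x f x.
Proof.
move=> mu1 mA muA fi af.
have -> : a = \int[mu]_x cst a x by rewrite Rintegral_cst//= mu1 mulr1.
apply: ae_le_Rintegral => //.
  apply/integrableP; split; first exact/measurable_EFinP.
  by rewrite /= integral_cst// mu1 mule1 ltry.
exists (~` A); split.
- exact: measurableC.
- have : (mu setT = mu A + mu (~` A))%E.
    by rewrite -measureU ?setUv//; [exact: measurableC|exact: setICr].
  rewrite mu1 muA; have : (0 <= mu (~` A))%E by [].
  case: (mu (~` A)) => //= r _; rewrite -EFinD => -[] /eqP.
  by rewrite -subr_eq0 opprD addrA subrr add0r oppr_eq0 => /eqP->.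
- by move=> x /= nax Ax; apply: nax; exact: af.
Qed.

End real_integrals.

(** * Virtual queues *)

Section queues.
Context {R : realType} {K : nat} (c : 'I_K -> R) (k : 'I_K).

Lemma queue_ge0 {d} {S : measurableType d} (y : nat -> S -> vec R K) t s :
  0 <= queue y c k t s.
Proof. by case: t => //= t; rewrite le_max lexx orbT. Qed.

(** Two sample spaces are allowed so that the queue can also be run on the space of histories. *)
Lemma eq_queue {d d'} {S : measurableType d} {S' : measurableType d'}
    (y : nat -> S -> vec R K) (y' : nat -> S' -> vec R K) t s s' :
  (forall u, (u < t)%N -> y u s = y' u s') ->
  queue y c k t s = queue y' c k t s'.
Proof.
elim: t => //= t IH yy'; rewrite IH; first by rewrite yy'.
by move=> u ut; apply: yy'; exact: ltnW.
Qed.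

Lemma measurable_queue {d} {S : measurableType d} (y : nat -> S -> vec R K) t :
  (forall u, measurable_fun setT (y u)) -> measurable_fun setT (queue y c k t).
Proof.
move=> my; elim: t => [|t IH] /=; first exact: measurable_cst.
apply: measurable_maxr => //; apply: measurable_funB => //.
apply: measurable_funD => //.
by apply: measurableT_comp; [exact: measurable_ycoord|exact: my].
Qed.

End queues.

(** * Drift-plus-penalty against a fixed achievable vector *)

Section QueueVersusAchievable.
Context {d : measure_display} {Omega : measurableType d} {R : realType}.
Context {K : nat}.
Context {dS : measure_display} {S : measurableType dS}.
Variables (P : probability S R) (rho : probability Omega R).
Variables (Y : Omega -> set 'rV[R]_K.+1) (p : @policy d Omega R K).
Variables (om : nat -> S -> Omega) (y : nat -> S -> vec R K).
Variables (c : 'I_K -> R).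
Hypothesis rn : run P om y rho Y p.

Lemma queue_indep k t (A : set R) (B : set Omega) :
  measurable A -> measurable B ->
  P (queue y c k t @^-1` A `&` om t @^-1` B) =
    (P (queue y c k t @^-1` A) * rho B)%E.
Proof.
move=> mA mB.
(* The queue is a function of the history: run the recursion on the decisions
   recorded in it. *)
pose y' u (g : t.-tuple (Omega * vec R K)) : vec R K :=
  if insub u is Some i then (tnth g i).2 else point.
(* For [u >= t] the value of [y'] is the default [point]; the queue at time [t] never reads these
   slots. *)
have qE s : queue y c k t s = queue y' c k t (hist om y t s).
  apply: eq_queue => u ut; rewrite /y' insubT/=.
  by rewrite tnth_mktuple.
have my' u : measurable_fun setT (y' u).
  rewrite /y'; case: insubP => [i _ _|_]; last exact: measurable_cst.
  by apply: measurableT_comp; [exact: measurable_snd|exact: measurable_tnth].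
pose G := queue y' c k t @^-1` A.
have mG : measurable G.
  by rewrite /G -[X in measurable X]setTI; exact: measurable_queue.
have -> : queue y c k t @^-1` A = hist om y t @^-1` G.
  by apply/seteqP; split => s /=; rewrite /G/= qE.
by rewrite (run_indep rn)// (run_law rn).
Qed.

Hypothesis Y_compact : forall w, compact (Y w).

(** At each sample point the decision minimizes over [Y (om t s)], hence does no worse than an
    option drawn from the kernel behind [v]. In expectation, each queue separates from the
    conditional mean of the option because it is independent of the event. *)
Lemma dpp_le_achievable V t (v : 'rV[R]_K.+1) :
  drift_plus_penalty om y Y c V -> achievable rho Y v ->
  P.-integrable setT (EFin \o (ycoord ord0 \o y t)) ->
  (forall k, P.-integrable setT (EFin \o queue y c k t)) ->
  (forall k, P.-integrable setT
     (EFin \o (fun s => queue y c k t s * ycoord (cidx k) (y t s)))) ->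
  \int[P]_s dpp_objective y c V t s (y t s) <=
    V * v ord0 ord0 + \sum_k (\int[P]_s queue y c k t s) * v ord0 (cidx k).
Proof.
move=> dpp [kap [kapY kapv]] iy0 iQ iQy.
have mz i : measurable_fun setT (EFin \o (ycoord i : vec R K -> R)).
  by apply/measurable_EFinP; exact: measurable_ycoord.
pose M i w := (\int[kap w]_z `|ycoord i z|%:E)%E.
pose m i w := (\int[kap w]_z (ycoord i z)%:E)%E.
have mker (f : vec R K -> \bar R) : measurable_fun setT f ->
    (forall z, 0 <= f z)%E ->
    measurable_fun setT (fun w => \int[kap w]_z f z)%E.
  move=> mf f0; apply: measurable_fun_integral_kernel => // U mU.
  exact: measurable_kernel.
have mM i : measurable_fun setT (M i).
  apply: mker => [|z]; last by rewrite lee_fin.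
  apply/measurable_EFinP; apply: measurableT_comp => //.
  exact: measurable_ycoord.
have iM i : rho.-integrable setT (M i).
  apply/integrableP; split => //.
  under eq_integral do rewrite gee0_abs ?integral_ge0//.
  by have [] := kapv i.
have mm i : measurable_fun setT (m i).
  rewrite (_ : m i = fun w => (\int[kap w]_z ((EFin \o ycoord i)^\+ z)%E -
                               \int[kap w]_z ((EFin \o ycoord i)^\- z)%E)%E).
    by apply: emeasurable_funB; apply: mker => //;
      [exact: measurable_funepos|exact: measurable_funeneg].
  by apply/funext => w; rewrite /m integralE.
have leM i w : (`|m i w| <= M i w)%E.
  exact: (le_abse_integral _ measurableT (mz i)).
have im i : rho.-integrable setT (m i).
  apply: le_integrable (iM i) => // w _.
  by rewrite [leRHS]gee0_abs//; exact: integral_ge0.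
(* The conditional mean [m i w] is known to be finite only [rho]-almost everywhere; [g] is its
   real-valued version. *)
pose g i w := fine (m i w).
have mg i : measurable_fun setT (EFin \o g i).
  by apply/measurable_EFinP; apply: measurableT_comp => //; exact: fine_measurable.
have ig i : rho.-integrable setT (EFin \o g i).
  apply: le_integrable (im i) => // w _.
  by rewrite /g/=; case: (m i w) => [r||]//=; rewrite normr0 leey.
have intg i : \int[rho]_w g i w = v ord0 i.
  rewrite /Rintegral (ae_eq_integral (m i))//; first by have [_ ->] := kapv i.
    exact: mg.
  by apply: filterS (integrable_ae measurableT (im i)) => w mfin _;
    rewrite /g fineK//; exact: mfin.
have law A := @run_law _ _ _ _ _ _ _ _ _ _ _ _ rn t A.
have mom := run_meas_om rn t.
have indep k := indep_mul mom (@queue_indep k t) (iQ k) (ig (cidx k)).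
have igom : P.-integrable setT (EFin \o (fun s => V * g ord0 (om t s))).
  exact: (integrableZl measurableT V (integrable_law mom law (ig ord0))).
have [iS intS] := @Rintegral_sum _ _ _ P _ (index_enum 'I_K)
  (fun k s => queue y c k t s * g (cidx k) (om t s)) (fun k => (indep k).1).
have [iS' _] := @Rintegral_sum _ _ _ P _ (index_enum 'I_K) _ iQy.
(* Independence is used backwards here: the bound becomes an expectation under [P], ready for a
   pointwise comparison. *)
have -> : V * v ord0 ord0 + \sum_k (\int[P]_s queue y c k t s) * v ord0 (cidx k) =
    \int[P]_s (V * g ord0 (om t s) +
               \sum_k queue y c k t s * g (cidx k) (om t s)).
  rewrite RintegralD// intS; congr (_ + _); last first.
    by apply: eq_bigr => k _; rewrite (indep k).2 intg.
  rewrite RintegralZl//; last exact: (integrable_law mom law (ig ord0)).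
  by rewrite -(intg ord0) /Rintegral (integral_law mom law (mg ord0)).
apply: ae_le_Rintegral => //.
- exact: (integrableD measurableT (integrableZl measurableT V iy0) iS').
- exact: (integrableD measurableT igom iS).
(* Outside a null set all conditional absolute moments are finite, and there the objective may be
   integrated coordinate by coordinate under [kap w]. *)
have Mfin : \forall s \ae P, forall i, M i (om t s) \is a fin_num.
  apply: filter_forall => i.
  apply: filterS (integrable_ae measurableT (integrable_law mom law (iM i))).
  by move=> s; exact.
apply: filterS Mfin => s Mfin; set w := om t s.
have iz i : (kap w).-integrable setT (EFin \o ycoord i).
  apply/integrableP; split => //; have := Mfin i.
  by rewrite ge0_fin_numE//; exact: integral_ge0.
have [iT intT] := @Rintegral_sum _ _ _ (kap w) _ (index_enum 'I_K)
  (fun k z => queue y c k t s * ycoord (cidx k) z)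
  (fun k => integrableZl measurableT (queue y c k t s) (iz (cidx k))).
have iV := integrableZl measurableT V (iz ord0).
have -> : V * g ord0 w + \sum_k queue y c k t s * g (cidx k) w =
    \int[kap w]_z dpp_objective y c V t s z.
  rewrite /dpp_objective RintegralD// intT RintegralZl//; congr (_ + _).
  by apply: eq_bigr => k _; rewrite RintegralZl.
apply: (@cst_le_Rintegral _ _ _ (kap w) (Y w) (dpp_objective y c V t s)).
- exact: prob_kernel.
- exact: measurable_compact.
- exact: kapY.
- exact: (integrableD measurableT iV iT).
- by move=> z Yz; exact: dpp.
Qed.

End QueueVersusAchievable.

(** * Deterministic inequalities behind the drift argument *)

(** Here [a], [x], [q], [e], [e0] stand for the expectations of [Q_k^2], [Q_k], [Q_k y_k], [y_k],
    [y_0]. Each conclusion telescopes: the drift, the [mu]-weighted queue growth, and the growth of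
    one queue. *)
Lemma drift_recursion_bound (R : realType) (K : nat) (c b mu : 'I_K -> R)
    (a x q e : 'I_K -> nat -> R) (e0 : nat -> R) (y0opt V : R) :
  (forall k, 0 <= mu k) ->
  (forall k t, a k t.+1 <= a k t + b k + 2 * q k t - 2 * (c k * x k t)) ->
  (forall t, V * e0 t + \sum_k q k t <= V * y0opt + \sum_k x k t * c k) ->
  (forall t, y0opt + \sum_k mu k * c k <= e0 t + \sum_k mu k * e k t) ->
  (forall k t, x k t + e k t - c k <= x k t.+1) ->
  (forall k, a k 0 = 0) -> (forall k, x k 0 = 0) ->
  forall t,
  [/\ \sum_k a k t <= t%:R * \sum_k b k +
        2 * V * (t%:R * y0opt - \sum_(i < t) e0 i),
      t%:R * y0opt - \sum_(i < t) e0 i <= \sum_k mu k * x k t &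
      forall k, \sum_(i < t) e k i <= t%:R * c k + x k t].
Proof.
move=> mu0 ha hV hmu hx a0 x0 t; split.
- elim: t => [|t IH].
    by rewrite big1 ?big_ord0 => [|k _]; rewrite ?a0// !mul0r subrr mulr0 addr0.
  have h : \sum_k a k t.+1 <= \sum_k a k t + \sum_k b k + 2 * \sum_k q k t -
      2 * \sum_k x k t * c k.
    rewrite !mulr_sumr -!big_split/= -sumrB; apply: ler_sum => k _.
    by rewrite [x k t * c k]mulrC.
  (* Adding twice [hV] to [h] cancels both [\sum_k q k t] and [\sum_k x k t * c k]. *)
  have := hV t; rewrite big_ord_recr/= -natr1 => {}hV.
  by nra.
- suff : t%:R * y0opt <= \sum_(i < t) e0 i + \sum_k mu k * x k t by lra.
  elim: t => [|t IH].
    by rewrite big_ord0 mul0r add0r sumr_ge0// => k _; rewrite x0 mulr0.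
  have h : \sum_k mu k * x k t + \sum_k mu k * e k t - \sum_k mu k * c k <=
      \sum_k mu k * x k t.+1.
    rewrite -!big_split/= -sumrB; apply: ler_sum => k _.
    by rewrite -mulrDr -mulrBr ler_wpM2l.
  by have := hmu t; rewrite big_ord_recr/= -natr1; lra.
- move=> k; elim: t => [|t IH]; first by rewrite big_ord0 x0 mul0r addr0.
  by have := hx k t; rewrite big_ord_recr/= -natr1; lra.
Qed.

(** Half of the sum of squares absorbs the linear term, leaving at most
    [2 * t * B + 4 * M / eps ^+ 2]. As [1 / eps ^+ 2 <= t], this is at most [t * C], and the same
    inequality puts its root below [t * C * eps]. *)
Lemma drift_convergence_rate (R : realType) (K : nat) (B M eps t : R)
    (mu x : 'I_K -> R) :
  0 <= B -> 0 < eps -> 1 / eps ^+ 2 <= t -> M = \sum_k mu k ^+ 2 ->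
  \sum_k x k ^+ 2 <= t * B + 2 * (1 / eps) * \sum_k mu k * x k ->
  forall k, 0 <= x k -> x k <= t * ((1 + 2 * B + 4 * M) * eps).
Proof.
move=> B0 eps0 tge ME hx k xk0.
set C := 1 + 2 * B + 4 * M.
have M0 : 0 <= M by rewrite ME; apply: sumr_ge0 => i _; exact: sqr_ge0.
have e2 : 0 < eps ^+ 2 by exact: exprn_gt0.
have t0 : 0 < t by apply: lt_le_trans tge; rewrite divr_gt0.
have te : 1 <= t * eps ^+ 2 by rewrite -ler_pdivrMr.
(* The summand 1 in [C] gives [C <= C ^+ 2], so that no square root of [C] is required. *)
have C1 : 1 <= C by rewrite /C; lra.
(* AM-GM: [2 V mu_k x_k <= 2 V^2 mu_k^2 + x_k^2 / 2] *)
have young : 2 * (1 / eps) * \sum_k mu k * x k <=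
    2 * (1 / eps) ^+ 2 * M + (\sum_k x k ^+ 2) / 2.
  rewrite ME !mulr_sumr mulr_suml -big_split/=; apply: ler_sum => i _.
  by have := sqr_ge0 (2 * (1 / eps) * mu i - x i); nra.
have V2 : (1 / eps) ^+ 2 <= t by rewrite expr_div_n expr1n.
have xle : x k ^+ 2 <= \sum_k x k ^+ 2.
  by rewrite (bigD1 k)//= lerDl; apply: sumr_ge0 => i _; exact: sqr_ge0.
have xC : x k ^+ 2 <= t * C by rewrite /C; nra.
have : x k ^+ 2 <= (t * (C * eps)) ^+ 2.
  apply: (le_trans xC).
  rewrite (_ : (t * (C * eps)) ^+ 2 = (t * C) * (C * (t * eps ^+ 2))); last by ring.
  by rewrite ler_peMr//; nra.
by rewrite ler_sqr// ?nnegrE// ?mulr_ge0//; lra.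
Qed.

(** * First and second moments on a probability space *)

Section moments.
Context {d} {T : measurableType d} {R : realType} (P : probability T R).

Lemma le_integrable_EFin (f g : T -> R) :
  measurable_fun setT f -> P.-integrable setT (EFin \o g) ->
  (forall s, `|f s| <= g s) -> P.-integrable setT (EFin \o f).
Proof.
move=> mf ig fg; apply: le_integrable ig => //; first exact/measurable_EFinP.
by move=> s _ /=; rewrite lee_fin (le_trans (fg s))// ler_norm.
Qed.

Lemma integrable_cst (r : R) : P.-integrable setT (EFin \o cst r).
Proof. exact: (@finite_measure_integrable_cst _ _ _ P). Qed.

Lemma integrable_sqr (f : T -> R) :
  measurable_fun setT f -> P.-integrable setT (EFin \o (fun s => f s ^+ 2)) ->
  P.-integrable setT (EFin \o f).
Proof.
move=> mf if2.
apply: (le_integrable_EFin mf (integrableD measurableT (integrable_cst 1) if2)).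
move=> s /=; rewrite -[f s ^+ 2]real_normK ?num_real//.
by have := sqr_ge0 (`|f s| - 1); nra.
Qed.

Lemma integrable_mul (f g : T -> R) :
  measurable_fun setT f -> P.-integrable setT (EFin \o (fun s => f s ^+ 2)) ->
  measurable_fun setT g -> P.-integrable setT (EFin \o (fun s => g s ^+ 2)) ->
  P.-integrable setT (EFin \o (fun s => f s * g s)).
Proof.
move=> mf if2 mg ig2.
apply: (le_integrable_EFin _ (integrableD measurableT if2 ig2)).
  exact: measurable_funM.
move=> s /=; rewrite ler_norml.
by have := sqr_ge0 (f s - g s); have := sqr_ge0 (f s + g s);
  have := sqr_ge0 (f s); have := sqr_ge0 (g s); nra.
Qed.

(** Jensen for the square: integrate the tangent bound [2 * r * f <= f ^+ 2 + r ^+ 2] at the mean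
    [r]. *)
Lemma sqr_Rintegral_le (f : T -> R) :
  measurable_fun setT f -> P.-integrable setT (EFin \o (fun s => f s ^+ 2)) ->
  (\int[P]_s f s) ^+ 2 <= \int[P]_s (f s ^+ 2).
Proof.
move=> mf if2; have iff := integrable_sqr mf if2.
set r := \int[P]_s f s.
have i2r := integrableZl measurableT (2 * r) iff.
have ic := integrable_cst (r ^+ 2).
have : \int[P]_s (2 * r * f s) <= \int[P]_s (f s ^+ 2 + cst (r ^+ 2) s).
  apply: le_Rintegral => //; first exact: (integrableD measurableT if2 ic).
  by move=> s _ /=; have := sqr_ge0 (f s - r); nra.
rewrite RintegralZl// RintegralD// Rintegral_cst//= probability_setT mulr1.
by rewrite -/r; nra.
Qed.

End moments.

(** * Expected queues and decisions along a run *)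

Section RunExpectations.
Context {d : measure_display} {Omega : measurableType d} {R : realType}.
Context {K : nat}.
Context {dS : measure_display} {S : measurableType dS}.
Variables (P : probability S R) (rho : probability Omega R).
Variables (Y : Omega -> set 'rV[R]_K.+1) (p : @policy d Omega R K).
Variables (om : nat -> S -> Omega) (y : nat -> S -> vec R K).
Variables (c : 'I_K -> R) (h : 'I_K.+1 -> R).
Hypothesis rn : run P om y rho Y p.
Hypothesis adm : admissible Y p.
Hypothesis Y_bounded : bounded_moments rho Y h.

Let my t i := measurable_decision rn i t.

Lemma integrable_objective t : P.-integrable setT (EFin \o (ycoord ord0 \o y t)).
Proof.
apply/integrableP; split; first exact/measurable_EFinP.
have [+ _] := Y_bounded adm rn t; rewrite unlock => /le_lt_trans; apply.
exact: ltry.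
Qed.

Lemma constraint_moment k t :
  P.-integrable setT (EFin \o (fun s => ycoord (cidx k) (y t s) ^+ 2)) /\
  \int[P]_s (ycoord (cidx k) (y t s) ^+ 2) <= h (cidx k).
Proof.
have [_ /(_ k)] := Y_bounded adm rn t; rewrite unlock => hk.
have i2 : P.-integrable setT (EFin \o (fun s => ycoord (cidx k) (y t s) ^+ 2)).
  apply/integrableP; split.
    by apply/measurable_EFinP; apply: measurable_funX; exact: my.
  under eq_integral do rewrite /= ger0_norm ?sqr_ge0//.
  by apply: le_lt_trans hk _; exact: ltry.
by split => //; rewrite -lee_fin /Rintegral fineK//; exact: integrable_fin_num i2.
Qed.

Lemma integrable_decision i t : P.-integrable setT (EFin \o (ycoord i \o y t)).
Proof.
have [k ->|->] := unliftP ord0 i; last exact: integrable_objective.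
by apply: integrable_sqr; [exact: my|exact: (constraint_moment k t).1].
Qed.

Lemma avgE i t :
  avg P y i t = (t%:R^-1 * \sum_(u < t) \int[P]_s ycoord i (y u s))%:E.
Proof.
rewrite /avg EFinM -sumEFin; congr (_ * _)%E; apply: eq_bigr => u _.
rewrite unlock /Rintegral fineK//.
exact: integrable_fin_num (integrable_decision i u).
Qed.

Let mQ k t : measurable_fun setT (queue y c k t).
Proof. by apply: measurable_queue => u; exact: run_meas_y rn u. Qed.

Lemma integrable_queue_sqr k t :
  P.-integrable setT (EFin \o (fun s => queue y c k t s ^+ 2)).
Proof.
elim: t => [|t IH].
  apply: (le_integrable_EFin _ (integrable_cst P 0)) => [|s].
    by apply: measurable_funX; exact: mQ.
  by rewrite /= expr0n normr0.
have iy2 := (constraint_moment k t).1.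
(* The dominating function comes from [(q + z - c)^2 <= 3 * (q^2 + z^2 + c^2)]. *)
have dom := integrableD measurableT
  (integrableD measurableT (integrableZl measurableT 3 IH)
                           (integrableZl measurableT 3 iy2))
  (integrable_cst P (3 * c k ^+ 2)).
apply: (le_integrable_EFin _ dom); first by apply: measurable_funX; exact: mQ.
move=> s; rewrite ger0_norm ?sqr_ge0//=.
set q := queue _ _ _ _ _; set z := ycoord _ _.
have := sqr_ge0 (q - z); have := sqr_ge0 (q + c k); have := sqr_ge0 (z + c k).
have := sqr_ge0 q; have := sqr_ge0 z; have := sqr_ge0 (c k).
by rewrite /Num.max; case: ifP => _; nra.
Qed.

Lemma integrable_queue k t : P.-integrable setT (EFin \o queue y c k t).
Proof. by apply: integrable_sqr => //; exact: integrable_queue_sqr. Qed.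

Lemma integrable_queue_decision k t : P.-integrable setT
  (EFin \o (fun s => queue y c k t s * ycoord (cidx k) (y t s))).
Proof.
apply: integrable_mul => //; [exact: integrable_queue_sqr|exact: my|].
exact: (constraint_moment k t).1.
Qed.

(** Truncation at 0 does not increase the square, so [Q_k(t+1)^2 <= (Q_k + y_k - c_k)^2]; expand,
    and bound [(y_k - c_k)^2] by [2 y_k^2 + 2 c_k^2]. *)
Lemma queue_drift k t :
  \int[P]_s (queue y c k t.+1 s ^+ 2) <=
    \int[P]_s (queue y c k t s ^+ 2) + (2 * h (cidx k) + 2 * c k ^+ 2) +
    2 * \int[P]_s (queue y c k t s * ycoord (cidx k) (y t s)) -
    2 * (c k * \int[P]_s queue y c k t s).
Proof.
have [iy2 hk] := constraint_moment k t.
have i1 := integrable_queue_sqr k t.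
have i2 := integrableZl measurableT 2 iy2.
have [b bE] : exists b, b = 2 * c k ^+ 2 by exists (2 * c k ^+ 2).
have i3 := integrable_cst P b.
have i4 := integrableZl measurableT 2 (integrable_queue_decision k t).
have i5 := integrableZl measurableT (- (2 * c k)) (integrable_queue k t).
have i12 := integrableD measurableT i1 i2.
have i123 := integrableD measurableT i12 i3.
have i1234 := integrableD measurableT i123 i4.
have i12345 := integrableD measurableT i1234 i5.
apply: (@le_trans _ _ (\int[P]_s (queue y c k t s ^+ 2 +
    2 * ycoord (cidx k) (y t s) ^+ 2 + cst b s +
    2 * (queue y c k t s * ycoord (cidx k) (y t s)) +
    (- (2 * c k)) * queue y c k t s))).
  apply: le_Rintegral => //; first exact: integrable_queue_sqr.
  move=> s _ /=; rewrite bE.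
  set q := queue _ _ _ _ _; set z := ycoord _ _.
  have := sqr_ge0 (q + z - c k); have := sqr_ge0 (z + c k).
  by rewrite /Num.max; case: ifP => _; nra.
rewrite !RintegralD// !RintegralZl//;
  do ?[exact: integrable_queue | exact: integrable_queue_decision].
by rewrite Rintegral_cst//= probability_setT mulr1 bE; nra.
Qed.

Lemma queue_growth k t :
  \int[P]_s queue y c k t s + \int[P]_s ycoord (cidx k) (y t s) - c k <=
  \int[P]_s queue y c k t.+1 s.
Proof.
have i1 := integrable_queue k t.
have i2 := integrable_decision (cidx k) t.
have i3 := integrable_cst P (- c k).
have i12 := integrableD measurableT i1 i2.
have -> : \int[P]_s queue y c k t s + \int[P]_s ycoord (cidx k) (y t s) - c k =
    \int[P]_s (queue y c k t s + ycoord (cidx k) (y t s) + cst (- c k) s).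
  by rewrite !RintegralD// Rintegral_cst//= probability_setT mulr1.
apply: le_Rintegral => //.
- exact: (integrableD measurableT i12 i3).
- exact: integrable_queue.
- by move=> s _ /=; rewrite le_max lexx.
Qed.

Lemma Rintegral_dpp_objective V t :
  \int[P]_s dpp_objective y c V t s (y t s) =
    V * \int[P]_s ycoord ord0 (y t s) +
    \sum_k \int[P]_s (queue y c k t s * ycoord (cidx k) (y t s)).
Proof.
have [iS intS] := @Rintegral_sum _ _ _ P _ (index_enum 'I_K) _
  (fun k => integrable_queue_decision k t).
have i0 := integrable_objective t.
by rewrite /dpp_objective RintegralD// ?intS ?RintegralZl//;
  exact: (integrableZl measurableT V i0).
Qed.

End RunExpectations.

(** * Drift-plus-penalty against the optimal value *)

Lemma limn_esup_lt_near (R : realType) (u : nat -> \bar R) (l : \bar R) :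
  (limn_esup u < l)%E -> \forall n \near \oo, (u n < l)%E.
Proof.
rewrite /limn_esup /limf_esup => /ereal_inf_lt[_ [A Aoo <-] supl].
apply: filterS Aoo => n An; apply: le_lt_trans supl.
by apply: ereal_sup_ubound; exists n.
Qed.

Section Optimality.
Context {d : measure_display} {Omega : measurableType d} {R : realType}.
Context {K : nat}.
Variables (rho : probability Omega R) (Y : Omega -> set 'rV[R]_K.+1).
Variables (c : 'I_K -> R) (h : 'I_K.+1 -> R) (y0opt : R).
Hypothesis Y_bounded : bounded_moments rho Y h.
Hypothesis Y_compact : forall w, compact (Y w).
Hypothesis y0optE : optimal_value rho Y c = y0opt%:E.

(* The vectors [v u] are the expectation vectors of the slots of a feasible run
   with value below [y0opt + delta]; only their average is nearly optimal. *)
Lemma achievable_near_optimal (delta : R) : 0 < delta ->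
  exists (n : nat) (v : nat -> 'rV[R]_K.+1),
  [/\ (0 < n)%N, forall u, achievable rho Y (v u),
      \sum_(u < n) v u ord0 ord0 <= n%:R * (y0opt + delta) &
      forall k, \sum_(u < n) v u ord0 (cidx k) <= n%:R * (c k + delta)].
Proof.
move=> delta0.
have : (ereal_inf (feasible_values rho Y c) < (y0opt + delta)%:E)%E.
  by rewrite -/(optimal_value rho Y c) y0optE lte_fin ltrDl.
move=> /ereal_inf_lt[_ [p [adm [dS [S [P [om [y [rn meets ->]]]]]]]] lt_opt].
have near0 := limn_esup_lt_near lt_opt.
have nearc : \forall n \near \oo, forall k,
    (avg P y (cidx k) n < (c k + delta)%:E)%E.
  apply: filter_forall => k; apply: limn_esup_lt_near.
  by apply: le_lt_trans (meets k) _; rewrite lte_fin ltrDl.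
(* A single horizon serves the objective and the finitely many constraints; [0 < n] allows
   multiplying the averages out. *)
have [n [[n0 nc] n1]] :=
  filter_ex (filterI (filterI near0 nearc) (nbhs_infty_gt 0)).
exists n, (fun u => \row_i \int[P]_s ycoord i (y u s)); split => //.
- by move=> u; apply: (run_integrable_achievable adm rn) => i;
    exact: (integrable_decision rn adm Y_bounded).
- move: n0; rewrite (avgE rn adm Y_bounded) lte_fin mulrC ltr_pdivrMr ?ltr0n//.
  by move=> /ltW le0; rewrite [leRHS]mulrC; under eq_bigr do rewrite mxE.
- move=> k; move: (nc k).
  rewrite (avgE rn adm Y_bounded) lte_fin mulrC ltr_pdivrMr ?ltr0n//.
  by move=> /ltW lek; rewrite [leRHS]mulrC; under eq_bigr do rewrite mxE.
Qed.

Context {dS : measure_display} {S : measurableType dS}.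
Variables (P : probability S R) (p : @policy d Omega R K).
Variables (om : nat -> S -> Omega) (y : nat -> S -> vec R K) (V : R).
Hypothesis rn : run P om y rho Y p.
Hypothesis adm : admissible Y p.
Hypothesis dpp : drift_plus_penalty om y Y c V.
Hypothesis V_ge0 : 0 <= V.

(** Slot [t] stays fixed while [u] runs over the slots of an unrelated near-optimal run. The bounds
    for the [v u] are summed, and nonnegative expected queues preserve the constraint
    inequalities. *)
Lemma dpp_le_optimal t :
  \int[P]_s dpp_objective y c V t s (y t s) <=
    V * y0opt + \sum_k (\int[P]_s queue y c k t s) * c k.
Proof.
set x := fun k => \int[P]_s queue y c k t s.
have x0 k : 0 <= x k by apply: Rintegral_ge0 => s _; exact: queue_ge0.
have W0 : 0 <= V + \sum_k x k by rewrite addr_ge0// sumr_ge0.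
apply/ler_addgt0Pr => e e0.
(* The slack [delta] enters the bound multiplied by [V + \sum_k x k], hence this choice; the 1 keeps
   the denominator positive. *)
have [//|n [v [n0 av v0 vk]]] :=
  @achievable_near_optimal (e / (1 + (V + \sum_k x k))).
  by rewrite divr_gt0// ltr_pwDl.
set delta := e / _ in v0 vk.
have delta0 : 0 <= delta by rewrite divr_ge0 ?ltW// ltr_pwDl.
have deltaE : delta * (V + \sum_k x k) <= e.
  rewrite /delta mulrAC ler_pdivrMr ?ltr_pwDl//; nra.
rewrite -(@ler_pM2l _ n%:R) ?ltr0n//.
have step u : \int[P]_s dpp_objective y c V t s (y t s) <=
    V * v u ord0 ord0 + \sum_k x k * v u ord0 (cidx k).
  apply: (dpp_le_achievable rn Y_compact dpp (av u)).
  - exact: (integrable_objective rn adm Y_bounded).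
  - by move=> k; exact: (integrable_queue _ rn adm Y_bounded).
  - by move=> k; exact: (integrable_queue_decision _ rn adm Y_bounded).
apply: (@le_trans _ _ (\sum_(u < n)
    (V * v u ord0 ord0 + \sum_k x k * v u ord0 (cidx k)))).
  by rewrite mulr_natl -[X in _ *+ X]card_ord -sumr_const; apply: ler_sum.
rewrite big_split/= -mulr_sumr exchange_big/=.
apply: (@le_trans _ _ (V * (n%:R * (y0opt + delta)) +
                       \sum_k x k * (n%:R * (c k + delta)))).
  apply: lerD; first by rewrite ler_wpM2l.
  by apply: ler_sum => k _; rewrite -mulr_sumr ler_wpM2l.
have -> : \sum_k x k * (n%:R * (c k + delta)) =
    n%:R * (\sum_k x k * c k + delta * \sum_k x k).
  rewrite mulr_sumr -big_split/= mulr_sumr.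
  by apply: eq_bigr => k _; ring.
have n0' : 0 <= n%:R :> R by [].
rewrite (_ : V * _ + _ = n%:R * (V * y0opt + \sum_k x k * c k +
  delta * (V + \sum_k x k))); last by ring.
by rewrite ler_wpM2l// lerD2l.
Qed.

End Optimality.

(** * Both bounds for [V = 1 / eps] *)

Theorem theorem1 (d : measure_display) (Omega : measurableType d)
    (R : realType) (K : nat) (rho : probability Omega R)
    (Y : Omega -> set 'rV[R]_K.+1) (c : 'I_K -> R) (h : 'I_K.+1 -> R)
    (y0opt : R) (mu : 'I_K -> R)
    (K_gt0 : (0 < K)%N)
    (h_ge0 : forall i, 0 <= h i)
    (Y_bounded : bounded_moments rho Y h)
    (Y_compact : forall w, compact (Y w))
    (Y_feasible : feasible rho Y c)
    (y0optE : optimal_value rho Y c = y0opt%:E)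
    (muP : lagrange_multiplier rho Y c y0opt mu) :
  exists C : R, forall eps : R, 0 < eps ->
    forall (p : policy) (dS : measure_display) (S : measurableType dS)
      (P : probability S R) (om : nat -> S -> Omega) (y : nat -> S -> vec R K),
    admissible Y p -> run P om y rho Y p ->
    drift_plus_penalty om y Y c (1 / eps) ->
    forall t : nat, 1 / eps ^+ 2 <= t%:R ->
      (avg P y ord0 t <= (y0opt + C * eps)%:E)%E /\
      forall k : 'I_K, (avg P y (cidx k) t <= (c k + C * eps)%:E)%E.
Proof.
have [mu0 mul] := muP.
pose b k := 2 * h (cidx k) + 2 * c k ^+ 2.
pose B := \sum_k b k.
pose M := \sum_k mu k ^+ 2.
have B0 : 0 <= B.
  by apply: sumr_ge0 => k _; rewrite addr_ge0// mulr_ge0// sqr_ge0.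
have M0 : 0 <= M by apply: sumr_ge0 => k _; exact: sqr_ge0.
(* This is the constant of [drift_convergence_rate]; it also exceeds the [B / 2] that the objective
   bound produces. *)
exists (1 + 2 * B + 4 * M) => eps eps0 p dS S P om y adm rn dpp t tge.
have V0 : 0 <= 1 / eps by rewrite divr_ge0// ltW.
have e2 : 0 < eps ^+ 2 by exact: exprn_gt0.
have t0 : 0 < t%:R :> R by apply: lt_le_trans tge; rewrite divr_gt0.
pose x k u := \int[P]_s queue y c k u s.
have x0 k u : 0 <= x k u by apply: Rintegral_ge0 => s _; exact: queue_ge0.
pose a k u := \int[P]_s (queue y c k u s ^+ 2).
pose q k u := \int[P]_s (queue y c k u s * ycoord (cidx k) (y u s)).
pose e k u := \int[P]_s ycoord (cidx k) (y u s).
pose e0 u := \int[P]_s ycoord ord0 (y u s).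
have optimal u : 1 / eps * e0 u + \sum_k q k u <=
    1 / eps * y0opt + \sum_k x k u * c k.
  rewrite -(Rintegral_dpp_objective c rn adm Y_bounded).
  exact: (dpp_le_optimal Y_bounded Y_compact y0optE rn adm dpp V0).
have lagrange u : y0opt + \sum_k mu k * c k <= e0 u + \sum_k mu k * e k u.
  have /mul := subset_closure (run_integrable_achievable adm rn
    (fun i => integrable_decision rn adm Y_bounded i u)).
  by rewrite mxE; under [in X in _ <= X -> _]eq_bigr do rewrite mxE.
have a0 k : a k 0 = 0.
  by rewrite /a /= expr0n Rintegral_cst// mul0r.
have x00 k : x k 0 = 0 by rewrite /x/= Rintegral_cst// mul0r.
have [drift mult cons] := drift_recursion_bound mu0
  (queue_drift c rn adm Y_bounded) optimal lagrange
  (queue_growth c rn adm Y_bounded) a0 x00 t.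
have sq : \sum_k x k t ^+ 2 <= \sum_k a k t.
  apply: ler_sum => k _; apply: sqr_Rintegral_le.
    by apply: measurable_queue => u; exact: run_meas_y rn u.
  exact: (integrable_queue_sqr _ rn adm Y_bounded).
have sq0 : 0 <= \sum_k x k t ^+ 2 by apply: sumr_ge0 => k _; exact: sqr_ge0.
split.
  rewrite (avgE rn adm Y_bounded) lee_fin mulrC ler_pdivrMr//.
  set E0 := \sum_(u < t) e0 u in drift mult *.
  (* Since the left side of the drift bound is nonnegative, [E0 <= t * (y0opt + B * eps / 2)]
     follows. *)
  have := le_trans sq0 (le_trans sq drift).
  rewrite -/B.
  have -> : t%:R * B + 2 * (1 / eps) * (t%:R * y0opt - E0) =
      (t%:R * B * eps + 2 * (t%:R * y0opt - E0)) / eps by field; rewrite gt_eqF.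
  rewrite pmulr_lge0 ?invr_gt0// => pos.
  have tB : 0 <= t%:R * eps * B by rewrite !mulr_ge0// ltW.
  have tM : 0 <= t%:R * eps * M by rewrite !mulr_ge0// ltW.
  have te : 0 <= t%:R * eps by rewrite !mulr_ge0// ltW.
  by lra.
move=> k; rewrite (avgE rn adm Y_bounded) lee_fin mulrC ler_pdivrMr//.
apply: (le_trans (cons k)); rewrite mulrDl [c k * _]mulrC lerD2l [leRHS]mulrC.
apply: (drift_convergence_rate (x := x^~ t) B0 eps0 tge erefl) => //.
(* Jensen passes to squares of expected queues, and [mult] trades the objective gap for the
   [mu]-weighted queues. *)
apply: le_trans sq (le_trans drift _).
by rewrite lerD2l// ler_wpM2l// mulr_ge0.
Qed.
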